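(* For every $x>0$, $$-\sum_{m=1}^{\infty}\frac{\psi'(mx+1)}{m^2}+\sum_{m=1}^{\infty}\frac{\psi'\left(\frac{m}{x}+1\right)}{m^2}+\frac{2}{x}\sum_{m=1}^{\infty}\frac{\gamma+\psi(mx+1)}{m^3}=\zeta(2)^2.$$
   Context: $\psi=\Gamma'/\Gamma$ is the digamma function, $\psi'$ its derivative, $\gamma$ Euler's constant and $\zeta$ the Riemann zeta function. *)

(* Defs.v *)
From Stdlib Require Import Reals.
From Coquelicot Require Import Coquelicot.
Open Scope R_scope.

(* Euler's integral of the second kind; meaningful for [0 < x]. *)
Definition Gamma (x : R) : R :=
  RInt_gen (fun t => Rpower t (x - 1) * exp (- t))
           (at_right 0) (Rbar_locally p_infty).

Definition digamma (x : R) : R := Derive Gamma x / Gamma x.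

Definition trigamma (x : R) : R := Derive digamma x.

(* [sum_n] includes both ends, so this is the limit of
   1 + 1/2 + ... + 1/(n+1) - ln (n+1). *)
Definition Euler_gamma : R :=
  real (Lim_seq (fun n => sum_n (fun k => / INR (S k)) n - ln (INR (S n)))).

(* The Dirichlet series of the Riemann zeta function; meaningful for [1 < s]. *)
Definition zeta (s : R) : R :=
  Series (fun n => / Rpower (INR (S n)) s).

(* Main.v *)
Require Import Defs.
From Stdlib Require Import Reals Lra.
From Coquelicot Require Import Coquelicot.
Open Scope R_scope.

(** The classical expansions
    [gamma + psi(z+1) = sum_n (1/n - 1/(n+z))] and
    [psi'(z+1) = sum_n 1/(n+z)^2] turn each of the three series into a double
    series over [m, n >= 1].  Exchanging the names of [m] and [n] in the second
    one puts all three over the common denominator [(n + m x)^2], and then the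
    terms combine exactly: with [a = m x], [b = n] and a factor [x^2] taken out,
    [- 1/(a^2 (a+b)^2) + 1/(b^2 (a+b)^2) + 2/(a^2 b (a+b)) = 1/(a^2 b^2)]
    ([double_term_identity]).  The double series of [1/(m^2 n^2)] is
    [zeta(2)^2], and the exchange of summations is Tonelli's theorem for
    nonnegative terms ([Series_swap]).

    The expansions are derived from Euler's integral without differentiating
    under the integral sign.  Integration by parts gives
    [Gamma (s+1) = s Gamma s], and integrating a tangent-line
    bound on [t^z], a convex function of [1/t], gives
    [s^z Gamma (s+1) <= Gamma (s+1+z)] and [Gamma (s+z) <= (s+z)^z Gamma s].
    At the integers these two bounds squeeze [ln Gamma (1+z)] into
    [- gamma z + sum_n (z/n - ln (1 + z/n))] ([ln_Gamma_series]); the case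
    [z = 1] also shows that the limit defining [gamma] exists.  The resulting
    series are differentiated term by term: a bound
    [M_n (w - z)^2] with [sum_n M_n] finite on the first-order Taylor remainders
    of the terms is enough ([is_derive_Series]), and [M_n = 1/n^2] works
    both for [ln Gamma] and for [psi]. *)

(** * Integrals over the half-line *)

Definition is_half_line_RInt (f : R -> R) (l : R) : Prop :=
  is_RInt_gen f (at_right 0) (Rbar_locally p_infty) l.

Lemma half_line_cut (P : R * R -> Prop) (c d : R) :
  0 < c -> (forall a b, 0 < a < c -> d < b -> P (a, b)) ->
  filter_prod (at_right 0) (Rbar_locally p_infty) P.
Proof.
  intros hc H.
  exists (fun a => 0 < a < c) (fun b => d < b); [| exists d; auto | auto].
  exists (mkposreal c hc). intros y hy h0. split; auto.
  apply Rabs_def2 in hy. unfold minus, plus, opp in hy. simpl in hy. lra.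
Qed.

Lemma half_line_RInt_ext (f g : R -> R) (l : R) :
  (forall t, 0 < t -> f t = g t) ->
  is_half_line_RInt f l -> is_half_line_RInt g l.
Proof.
  intros H. apply is_RInt_gen_ext.
  apply half_line_cut with 1 1; [lra|]. intros a b ha hb t ht. simpl in ht.
  apply H. rewrite Rmin_left in ht; lra.
Qed.

Lemma half_line_RInt_ge_0 (f : R -> R) (l : R) :
  (forall t, 0 < t -> 0 <= f t) -> is_half_line_RInt f l -> 0 <= l.
Proof.
  intros H Hf.
  apply Rle_trans with (norm (scal 0 l)); [apply norm_ge_0|].
  refine (RInt_gen_norm (fun t => scal 0 (f t)) f _ _ _ _ _ Hf).
  - apply half_line_cut with 1 1; simpl; intros; lra.
  - apply half_line_cut with 1 1; [lra|]. intros a b ha hb t ht. simpl in ht.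
    unfold norm, scal; simpl. unfold abs, mult; simpl.
    rewrite Rmult_0_l, Rabs_R0. apply H. lra.
  - exact (is_RInt_gen_scal f 0 l Hf).
Qed.

Lemma half_line_RInt_derive (F f : R -> R) (la lb : R) :
  (forall t, 0 < t -> is_derive F t (f t)) ->
  (forall t, 0 < t -> continuous f t) ->
  filterlim F (at_right 0) (locally la) ->
  filterlim F (Rbar_locally p_infty) (locally lb) ->
  is_half_line_RInt f (lb - la).
Proof.
  intros HF Hf Ha Hb.
  apply half_line_RInt_ext with (Derive F).
  { intros t ht. apply is_derive_unique. auto. }
  refine (is_RInt_gen_Derive F la lb _ _ Ha Hb);
    apply half_line_cut with 1 1; try lra; intros a b ha hb t ht; simpl in ht;
    rewrite Rmin_left in ht by lra.
  - exists (f t). apply HF. lra.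
  - apply continuous_ext_loc with f; [|apply Hf; lra].
    assert (ht0 : 0 < t) by lra.
    exists (mkposreal t ht0). intros y hy. symmetry. apply is_derive_unique, HF.
    apply Rabs_def2 in hy. unfold minus, plus, opp in hy. simpl in hy. lra.
Qed.

(** For a nonnegative integrand the integrals over [[a, b]] grow with the
    interval, so they converge to their least upper bound. *)
Lemma ex_half_line_RInt_bounded (f : R -> R) (M : R) :
  (forall t, 0 < t -> continuous f t) ->
  (forall t, 0 < t -> 0 <= f t) ->
  (forall a b, 0 < a < b -> RInt f a b <= M) ->
  exists l, is_half_line_RInt f l.
Proof.
  intros Hc Hp HM.
  assert (Hex : forall a b, 0 < a -> 0 < b -> ex_RInt f a b).
  { intros a b ha hb. apply (ex_RInt_continuous (V := R_CompleteNormedModule)).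
    intros t ht. apply Hc.
    apply Rlt_le_trans with (2 := proj1 ht). now apply Rmin_glb_lt. }
  set (E := fun y => exists a b, 0 < a < b /\ y = RInt f a b).
  destruct (completeness E) as [l [Hub Hlub]].
  { exists M. intros y (a & b & hab & ->). auto. }
  { exists (RInt f 1 2), 1, 2. split; [lra|reflexivity]. }
  exists l. intros P [eps HP].
  assert (exists a0 b0, 0 < a0 < b0 /\ l - eps < RInt f a0 b0)
    as (a0 & b0 & h0 & hl).
  { apply Classical_Prop.NNPP. intros N.
    assert (l <= l - eps); [|destruct eps; simpl in *; lra].
    apply Hlub. intros y (a & b & hab & ->). apply Rnot_lt_le. intros h.
    apply N. now exists a, b. }
  apply half_line_cut with a0 b0; [lra|]. intros a b ha hb. simpl.
  exists (RInt f a b). split.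
  { apply (RInt_correct (V := R_CompleteNormedModule)). apply Hex; lra. }
  apply HP. change (Rabs (RInt f a b - l) < eps). apply Rabs_def1.
  - assert (RInt f a b <= l) by (apply Hub; exists a, b; split; [lra|reflexivity]).
    destruct eps; simpl in *; lra.
  - assert (RInt f a0 b0 <= RInt f a b); [|lra].
    rewrite <- (RInt_Chasles f a a0 b) by (apply Hex; lra).
    rewrite <- (RInt_Chasles f a0 b0 b) by (apply Hex; lra).
    assert (0 <= RInt f a a0) by
      (apply RInt_ge_0; [lra|apply Hex; lra|intros; apply Hp; lra]).
    assert (0 <= RInt f b0 b) by
      (apply RInt_ge_0; [lra|apply Hex; lra|intros; apply Hp; lra]).
    unfold plus; simpl; lra.
Qed.

(** * Euler's integral *)

Definition Gamma_integrand (s t : R) : R := Rpower t (s - 1) * exp (- t).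

Lemma Gamma_integrand_pos s t : 0 < Gamma_integrand s t.
Proof. apply Rmult_lt_0_compat; apply exp_pos. Qed.

Lemma Gamma_integrand_shift s z t :
  Gamma_integrand (s + z) t = Rpower t z * Gamma_integrand s t.
Proof.
  unfold Gamma_integrand. replace (s + z - 1) with (z + (s - 1)) by ring.
  rewrite Rpower_plus. ring.
Qed.

(** The integrand for [s + 1] is the primitive that integration by parts uses;
    its boundary values vanish for [1 <= s]. *)
Lemma is_derive_Gamma_integrand s t : 0 < t ->
  is_derive (Gamma_integrand (s + 1)) t
    (s * Gamma_integrand s t - Gamma_integrand (s + 1) t).
Proof.
  intros ht. unfold Gamma_integrand, Rpower. auto_derive; [exact ht|].
  replace (s + 1 - 1) with s by ring.
  replace (exp ((s - 1) * ln t)) with (exp (s * ln t) / t); [field; lra|].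
  replace ((s - 1) * ln t) with (s * ln t + - ln t) by ring.
  rewrite exp_plus, exp_Ropp, exp_ln by auto. reflexivity.
Qed.

Lemma continuous_Gamma_integrand s t : 0 < t -> continuous (Gamma_integrand s) t.
Proof.
  intros ht. replace s with (s - 1 + 1) by ring. apply (ex_derive_continuous (V := R_NormedModule)).
  eexists. now apply is_derive_Gamma_integrand.
Qed.

Lemma exp_nondecreasing u v : u <= v -> exp u <= exp v.
Proof. intros [h | ->]; [left; now apply exp_increasing | right; reflexivity]. Qed.

Lemma ln_le_sub1 u : 0 < u -> ln u <= u - 1.
Proof.
  intros hu. pose proof (exp_ineq1_le (ln u)). rewrite exp_ln in *; lra.
Qed.

(** Bounding [ln] by its tangent at [2 s] makes half of the exponential absorb
    the power of [t]. *)
Lemma Gamma_integrand_decay s : 1 <= s ->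
  exists C, 0 < C /\ forall t, 0 < t -> Gamma_integrand s t <= C * exp (- t / 2).
Proof.
  intros hs. exists (exp ((s - 1) * ln (2 * s))). split; [apply exp_pos|].
  intros t ht. unfold Gamma_integrand, Rpower.
  rewrite <- !exp_plus. apply exp_nondecreasing.
  pose proof (ln_le_sub1 (t / (2 * s))) as H.
  rewrite ln_div in H by lra.
  assert (h : 0 < t / (2 * s)) by (apply Rdiv_lt_0_compat; lra).
  specialize (H h).
  assert (H1 : (s - 1) * ln t <= (s - 1) * (ln (2 * s) + t / (2 * s))).
  { apply Rmult_le_compat_l; lra. }
  assert (s * (t / (2 * s)) = t / 2) by (field; lra).
  nra.
Qed.

Lemma Gamma_integrand_lim_p_infty s : 1 <= s ->
  filterlim (Gamma_integrand s) (Rbar_locally p_infty) (locally 0).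
Proof.
  intros hs. destruct (Gamma_integrand_decay s hs) as [C [hC H]].
  apply filterlim_locally. intros eps. exists (2 * C / eps). intros t ht.
  change (Rabs (Gamma_integrand s t - 0) < eps).
  pose proof (cond_pos eps) as he.
  assert (h0 : 0 < 2 * C / eps) by (apply Rdiv_lt_0_compat; lra).
  rewrite Rminus_0_r, Rabs_pos_eq by (left; apply Gamma_integrand_pos).
  apply Rle_lt_trans with (1 := H t ltac:(lra)).
  replace (- t / 2) with (- (t / 2)) by field. rewrite exp_Ropp.
  pose proof (exp_ineq1_le (t / 2)).
  apply (Rmult_lt_reg_r (exp (t / 2))); [apply exp_pos|].
  rewrite Rmult_assoc, Rinv_l, Rmult_1_r by (pose proof (exp_pos (t / 2)); lra).
  apply Rlt_le_trans with (eps * (t / 2)).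
  - apply (Rmult_lt_compat_l eps) in ht; auto.
    replace (eps * (2 * C / eps)) with (2 * C) in ht by (field; lra). lra.
  - apply Rmult_le_compat_l; lra.
Qed.

(** For [t <= 1] the integrand is at most [t], since [s - 1 >= 1]. *)
Lemma Gamma_integrand_lim_0 s : 2 <= s ->
  filterlim (Gamma_integrand s) (at_right 0) (locally 0).
Proof.
  intros hs. apply filterlim_locally. intros eps.
  assert (he : 0 < Rmin eps 1) by (apply Rmin_glb_lt; [apply cond_pos|lra]).
  exists (mkposreal _ he). intros t ht h0.
  change (Rabs (Gamma_integrand s t - 0) < eps).
  apply Rabs_def2 in ht. unfold minus, plus, opp in ht. simpl in ht.
  pose proof (Rmin_l eps 1). pose proof (Rmin_r eps 1).
  rewrite Rminus_0_r, Rabs_pos_eq by (left; apply Gamma_integrand_pos).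
  apply Rle_lt_trans with t; [|lra].
  unfold Gamma_integrand, Rpower. rewrite <- exp_plus.
  rewrite <- (exp_ln t) at 3 by auto. apply exp_nondecreasing.
  assert (ln t <= 0) by (rewrite <- ln_1; apply ln_le; lra).
  nra.
Qed.

Lemma is_half_line_RInt_Gamma s : 1 <= s ->
  is_half_line_RInt (Gamma_integrand s) (Gamma s).
Proof.
  intros hs.
  refine (RInt_gen_correct (V := R_CompleteNormedModule) (Gamma_integrand s) _).
  destruct (Gamma_integrand_decay s hs) as [C [hC H]].
  apply ex_half_line_RInt_bounded with (2 * C).
  - apply continuous_Gamma_integrand.
  - intros; left; apply Gamma_integrand_pos.
  - intros a b hab.
    assert (HI : is_RInt (fun t => C * exp (- t / 2)) a b
      (minus (- 2 * C * exp (- b / 2)) (- 2 * C * exp (- a / 2)))).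
    { apply (is_RInt_derive (V := R_CompleteNormedModule) (fun t => - 2 * C * exp (- t / 2))).
      - intros t _. auto_derive; [auto|]. unfold Rdiv. field.
      - intros t _. apply (ex_derive_continuous (V := R_NormedModule)). auto_derive. auto. }
    apply Rle_trans with (minus (- 2 * C * exp (- b / 2)) (- 2 * C * exp (- a / 2))).
    + rewrite <- (is_RInt_unique _ _ _ _ HI). apply RInt_le; [lra| | |].
      * apply (ex_RInt_continuous (V := R_CompleteNormedModule)).
        intros t ht. rewrite Rmin_left in ht by lra.
        apply continuous_Gamma_integrand. lra.
      * eexists; exact HI.
      * intros t ht. apply H. lra.
    + unfold minus, plus, opp; simpl.
      assert (exp (- a / 2) <= 1) by (rewrite <- exp_0; apply exp_nondecreasing; lra).
      pose proof (exp_pos (- b / 2)). nra.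
Qed.

Lemma Gamma_unique s l : is_half_line_RInt (Gamma_integrand s) l -> Gamma s = l.
Proof. exact (is_RInt_gen_unique (V := R_CompleteNormedModule) (Gamma_integrand s) l). Qed.

Lemma Gamma_1 : Gamma 1 = 1.
Proof.
  apply Gamma_unique. replace 1 with (0 - -1) at 2 by ring.
  apply half_line_RInt_ext with (fun t => exp (- t)).
  { intros t ht. unfold Gamma_integrand. rewrite Rminus_diag, Rpower_O by auto. ring. }
  apply half_line_RInt_derive with (fun t => - exp (- t)).
  - intros t _. auto_derive; [auto|]. ring.
  - intros t _. apply (ex_derive_continuous (V := R_NormedModule)). auto_derive. auto.
  - apply (filterlim_filter_le_1 (F := locally 0)).
    { intros P [d HP]. exists d. auto. }
    replace (-1) with (- exp (- 0)) by (rewrite Ropp_0, exp_0; ring).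
    apply (ex_derive_continuous (V := R_NormedModule) (fun t => - exp (- t)) 0).
    auto_derive. auto.
  - apply filterlim_ext_loc with (fun t => - Gamma_integrand 1 t).
    + exists 0. intros t ht. unfold Gamma_integrand.
      rewrite Rminus_diag, Rpower_O by auto. ring.
    + rewrite <- Ropp_0. eapply filterlim_comp.
      { apply Gamma_integrand_lim_p_infty. lra. }
      apply (filterlim_opp (V := R_NormedModule) 0).
Qed.

(** Integrate the derivative of [t^s exp (- t)] over the half-line. *)
Lemma Gamma_succ s : 1 <= s -> Gamma (s + 1) = s * Gamma s.
Proof.
  intros hs. apply Gamma_unique.
  assert (H : is_half_line_RInt
    (fun t => s * Gamma_integrand s t - Gamma_integrand (s + 1) t) (0 - 0)).
  { apply half_line_RInt_derive with (Gamma_integrand (s + 1)).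
    - intros; now apply is_derive_Gamma_integrand.
    - intros t ht.
      apply (continuous_minus (V := R_NormedModule)
        (fun t => s * Gamma_integrand s t) (Gamma_integrand (s + 1))).
      + apply (continuous_scal_r (V := R_NormedModule) s (Gamma_integrand s)).
        now apply continuous_Gamma_integrand.
      + now apply continuous_Gamma_integrand.
    - apply Gamma_integrand_lim_0. lra.
    - apply Gamma_integrand_lim_p_infty. lra. }
  replace (s * Gamma s) with (minus (scal s (Gamma s)) (0 - 0)).
  2: { unfold minus, plus, opp, scal; simpl; unfold mult; simpl; ring. }
  eapply half_line_RInt_ext.
  2: exact (is_RInt_gen_minus _ _ _ _
       (is_RInt_gen_scal _ s _ (is_half_line_RInt_Gamma s hs)) H).
  intros t _. unfold minus, plus, opp, scal; simpl; unfold mult; simpl. ring.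
Qed.

(** * Bounds on ratios of Gamma values *)

(** The tangent line at [1/a] to [t^z] as a convex function of [1/t]; suitable
    choices of [a] give the two ratio bounds below. *)
Lemma Rpower_ge_tangent t a z : 0 < t -> 0 < a -> 0 <= z ->
  Rpower a z * (1 + z * (1 - a / t)) <= Rpower t z.
Proof.
  intros ht ha hz. unfold Rpower.
  pose proof (ln_le_sub1 (a / t) (Rdiv_lt_0_compat _ _ ha ht)) as H.
  rewrite ln_div in H by auto.
  replace (z * ln t) with (z * ln a + z * (ln t - ln a)) by ring.
  rewrite exp_plus. apply Rmult_le_compat_l; [left; apply exp_pos|].
  apply Rle_trans with (2 := exp_ineq1_le _).
  apply Rplus_le_compat_l, Rmult_le_compat_l; lra.
Qed.

Lemma half_line_RInt_lincomb_le f g h (p q lf lg lh : R) :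
  is_half_line_RInt f lf -> is_half_line_RInt g lg -> is_half_line_RInt h lh ->
  (forall t, 0 < t -> p * f t - q * g t <= h t) -> p * lf - q * lg <= lh.
Proof.
  intros Hf Hg Hh H.
  assert (0 <= minus lh (minus (scal p lf) (scal q lg))) as H0.
  { eapply half_line_RInt_ge_0.
    2: exact (is_RInt_gen_minus _ _ _ _ Hh (is_RInt_gen_minus _ _ _ _
         (is_RInt_gen_scal _ p _ Hf) (is_RInt_gen_scal _ q _ Hg))).
    intros t ht. specialize (H t ht).
    unfold minus, plus, opp, scal; simpl; unfold mult; simpl. lra. }
  revert H0. unfold minus, plus, opp, scal; simpl; unfold mult; simpl. lra.
Qed.

(** Multiply the tangent bound at [a = s] by the integrand for [s + 1] and
    integrate; with this choice of [a] the terms in [z] cancel. *)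
Lemma Gamma_ratio_lower s z : 1 <= s -> 0 <= z ->
  Rpower s z * Gamma (s + 1) <= Gamma (s + 1 + z).
Proof.
  intros hs hz.
  replace (Rpower s z * Gamma (s + 1)) with
    (Rpower s z * (1 + z) * Gamma (s + 1) - Rpower s z * z * s * Gamma s)
    by (rewrite Gamma_succ by auto; ring).
  eapply half_line_RInt_lincomb_le; try (apply is_half_line_RInt_Gamma; lra).
  intros t ht. rewrite !Gamma_integrand_shift, Rpower_1 by auto.
  pose proof (Rpower_ge_tangent t s z ht ltac:(lra) hz) as H.
  apply (Rmult_le_compat_r (t * Gamma_integrand s t)) in H.
  2: { left. apply Rmult_lt_0_compat; auto. apply Gamma_integrand_pos. }
  apply Rle_trans with (2 := H). right. field. lra.
Qed.

(** With [u = s + z], the tangent bound for [(1/t)^z] at [1/u], multiplied by the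
    integrand for [u], bounds [Gamma s] below; again the terms in [z] cancel. *)
Lemma Gamma_ratio_upper s z : 1 <= s -> 0 <= z ->
  Gamma (s + z) <= Rpower (s + z) z * Gamma s.
Proof.
  intros hs hz. set (u := s + z).
  assert (hu : 1 <= u) by (unfold u; lra).
  apply (Rmult_le_reg_l (Rpower u (- z))); [apply exp_pos|].
  rewrite <- Rmult_assoc, <- Rpower_plus, Rplus_opp_l, Rpower_O, Rmult_1_l by lra.
  replace (Rpower u (- z) * Gamma u) with
    (Rpower u (- z) * (1 + z) * Gamma u - Rpower u (- z) * (z / u) * Gamma (u + 1))
    by (rewrite Gamma_succ by auto; field; lra).
  eapply half_line_RInt_lincomb_le; try (apply is_half_line_RInt_Gamma; lra).
  intros t ht.
  replace (Gamma_integrand s t) with (Rpower t (- z) * Gamma_integrand u t)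
    by (rewrite <- Gamma_integrand_shift; f_equal; unfold u; ring).
  rewrite Gamma_integrand_shift, Rpower_1 by auto.
  pose proof (Rpower_ge_tangent (/ t) (/ u) z ltac:(apply Rinv_0_lt_compat; lra)
    ltac:(apply Rinv_0_lt_compat; lra) hz) as H.
  replace (Rpower t (- z)) with (Rpower (/ t) z)
    by (unfold Rpower; rewrite ln_Rinv by auto; f_equal; ring).
  replace (Rpower u (- z)) with (Rpower (/ u) z)
    by (unfold Rpower; rewrite ln_Rinv by lra; f_equal; ring).
  apply (Rmult_le_compat_r (Gamma_integrand u t)) in H; [|left; apply Gamma_integrand_pos].
  apply Rle_trans with (2 := H). right. field. lra.
Qed.

(** * Series of nonnegative terms *)

Lemma INR_S_ge_1 n : 1 <= INR (S n).
Proof. rewrite S_INR. pose proof (pos_INR n). lra. Qed.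

Lemma sum_n_S (a : nat -> R) n : sum_n a (S n) = sum_n a n + a (S n).
Proof. exact (sum_Sn a n). Qed.

Lemma ex_series_nonneg_bounded (a : nat -> R) M :
  (forall n, 0 <= a n) -> (forall n, sum_n a n <= M) -> ex_series a.
Proof.
  intros H HM. destruct (ex_finite_lim_seq_incr (sum_n a) M) as [l Hl]; auto.
  - intros n. rewrite sum_n_S. specialize (H (S n)). lra.
  - exists l. exact Hl.
Qed.

Lemma ex_series_nonneg_le (a b : nat -> R) :
  (forall n, 0 <= a n <= b n) -> ex_series b -> ex_series a.
Proof.
  intros H. apply (ex_series_le (V := R_CompleteNormedModule)). intros n.
  change (Rabs (a n) <= b n). rewrite Rabs_pos_eq; apply H.
Qed.

Lemma sum_n_le_Series (a : nat -> R) n :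
  (forall n, 0 <= a n) -> ex_series a -> sum_n a n <= Series a.
Proof.
  intros H Ha.
  apply (is_lim_seq_incr_compare (sum_n a)); [exact (Series_correct a Ha)|].
  intros m. rewrite sum_n_S. specialize (H (S m)). lra.
Qed.

Lemma sum_n_term_le (a : nat -> R) n : (forall n, 0 <= a n) -> a n <= sum_n a n.
Proof.
  intros H. assert (Hs : forall m, 0 <= sum_n a m).
  { induction m as [|m IH]; [rewrite sum_O; auto|].
    rewrite sum_n_S. specialize (H (S m)). lra. }
  destruct n as [|n]; [rewrite sum_O; lra|]. rewrite sum_n_S. specialize (Hs n). lra.
Qed.

Lemma sum_n_Series_swap (a : nat -> nat -> R) N :
  (forall n, ex_series (fun m => a m n)) ->
  ex_series (fun m => sum_n (a m) N) /\
  sum_n (fun n => Series (fun m => a m n)) N = Series (fun m => sum_n (a m) N).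
Proof.
  intros H. induction N as [|N [IH1 IH2]].
  - split.
    + apply ex_series_ext with (2 := H 0%nat). intros m. now rewrite sum_O.
    + rewrite sum_O. apply Series_ext. intros m. now rewrite sum_O.
  - split.
    + apply ex_series_ext with (fun m => plus (sum_n (a m) N) (a m (S N))).
      { intros m. now rewrite sum_Sn. }
      apply (ex_series_plus (V := R_NormedModule)); auto.
    + rewrite sum_n_S, IH2, <- Series_plus by auto.
      apply Series_ext. intros m. now rewrite sum_n_S.
Qed.

(** Each finite sum of columns is a series of partial row sums, hence bounded by
    the iterated sum over rows. *)
Lemma Series_swap_le (a : nat -> nat -> R) :
  (forall m n, 0 <= a m n) -> (forall m, ex_series (a m)) ->
  ex_series (fun m => Series (a m)) ->
  (forall n, ex_series (fun m => a m n)) /\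
  ex_series (fun n => Series (fun m => a m n)) /\
  Series (fun n => Series (fun m => a m n)) <= Series (fun m => Series (a m)).
Proof.
  intros Hp Hrow Hsum.
  assert (Hcol : forall n, ex_series (fun m => a m n)).
  { intros n. apply ex_series_nonneg_le with (2 := Hsum). intros m. split; auto.
    apply Rle_trans with (sum_n (a m) n); [now apply sum_n_term_le|].
    now apply sum_n_le_Series. }
  assert (Hb : forall N, sum_n (fun n => Series (fun m => a m n)) N
                         <= Series (fun m => Series (a m))).
  { intros N. destruct (sum_n_Series_swap a N Hcol) as [_ ->].
    apply Series_le; auto. intros m. split.
    - apply Rle_trans with (a m N); auto. now apply sum_n_term_le.
    - now apply sum_n_le_Series. }
  assert (Hex : ex_series (fun n => Series (fun m => a m n))).
  { apply ex_series_nonneg_bounded with (2 := Hb). intros n.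
    apply Rle_trans with (sum_n (fun m => a m n) 0); [rewrite sum_O; auto|].
    now apply sum_n_le_Series. }
  split; [exact Hcol|]. split; [exact Hex|].
  exact (is_lim_seq_le _ (fun _ => Series (fun m => Series (a m))) (Finite _) (Finite _)
           Hb (Series_correct _ Hex) (is_lim_seq_const _)).
Qed.

(** Tonelli: the inequality applied to the array and to its transpose. *)
Lemma Series_swap (a : nat -> nat -> R) :
  (forall m n, 0 <= a m n) -> (forall m, ex_series (a m)) ->
  ex_series (fun m => Series (a m)) ->
  (forall n, ex_series (fun m => a m n)) /\
  ex_series (fun n => Series (fun m => a m n)) /\
  Series (fun n => Series (fun m => a m n)) = Series (fun m => Series (a m)).
Proof.
  intros Hp Hrow Hsum.
  destruct (Series_swap_le a Hp Hrow Hsum) as (Hcol & Hex & Hle).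
  destruct (Series_swap_le (fun n m => a m n)) as (_ & _ & Hge); auto.
  repeat split; auto. now apply Rle_antisym.
Qed.

(** Telescoping: [1/(n+1)^2 <= 1/n - 1/(n+1)]. *)
Lemma ex_series_inv_sqr : ex_series (fun k => / INR (S k) ^ 2).
Proof.
  apply ex_series_nonneg_bounded with 2.
  - intros n. pose proof (INR_S_ge_1 n). left. apply Rinv_0_lt_compat. nra.
  - assert (H : forall n, sum_n (fun k => / INR (S k) ^ 2) n <= 2 - / INR (S n)).
    { induction n as [|n IH].
      - rewrite sum_O. simpl. lra.
      - rewrite sum_n_S. rewrite (S_INR (S n)). pose proof (INR_S_ge_1 n).
        set (u := INR (S n)) in *.
        assert (/ (u + 1) ^ 2 <= / u - / (u + 1)); [|lra].
        replace (/ u - / (u + 1)) with (/ (u * (u + 1))) by (field; lra).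
        apply Rinv_le_contravar; nra. }
    intros n. specialize (H n). pose proof (INR_S_ge_1 n).
    assert (0 < / INR (S n)) by (apply Rinv_0_lt_compat; lra). lra.
Qed.

(** * Termwise differentiation *)

Lemma is_derive_quadratic_remainder (f : R -> R) z l c M : 0 < c ->
  (forall w, Rabs (w - z) < c -> Rabs (f w - f z - (w - z) * l) <= M * (w - z) ^ 2) ->
  is_derive f z l.
Proof.
  intros hc H. apply is_derive_Reals. intros eps he.
  assert (hM : 0 < eps / (Rabs M + 1)).
  { apply Rdiv_lt_0_compat; auto. pose proof (Rabs_pos M). lra. }
  assert (hd : 0 < Rmin c (eps / (Rabs M + 1))) by (now apply Rmin_glb_lt).
  exists (mkposreal _ hd). intros h h0 hh. simpl in hh.
  pose proof (Rmin_l c (eps / (Rabs M + 1))).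
  pose proof (Rmin_r c (eps / (Rabs M + 1))).
  specialize (H (z + h)). replace (z + h - z) with h in H by ring.
  specialize (H ltac:(lra)).
  replace ((f (z + h) - f z) / h - l) with ((f (z + h) - f z - h * l) / h)
    by (field; auto).
  rewrite Rabs_div by auto.
  assert (hp : 0 < Rabs h) by now apply Rabs_pos_lt.
  apply (Rmult_lt_reg_r (Rabs h)); auto.
  unfold Rdiv. rewrite Rmult_assoc, Rinv_l, Rmult_1_r by lra.
  apply Rle_lt_trans with (1 := H).
  rewrite <- (pow2_abs h). simpl. rewrite Rmult_1_r, <- Rmult_assoc.
  apply Rmult_lt_compat_r; auto.
  pose proof (Rle_abs M). pose proof (Rabs_pos M).
  assert (Rabs h * (Rabs M + 1) < eps).
  { apply (Rmult_lt_compat_r (Rabs M + 1)) in hh; [|lra].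
    apply Rlt_le_trans with (1 := hh).
    apply Rle_trans with (eps / (Rabs M + 1) * (Rabs M + 1)).
    - apply Rmult_le_compat_r; lra.
    - right. field. lra. }
  nra.
Qed.

(** Quadratic remainders add up: the remainder of the sum is at most
    [Series M * (w - z)^2]. *)
Lemma is_derive_Series (a : nat -> R -> R) (b M : nat -> R) z c : 0 < c ->
  (forall w, Rabs (w - z) < c -> ex_series (fun k => a k w)) ->
  ex_series b -> ex_series M ->
  (forall k w, Rabs (w - z) < c ->
     Rabs (a k w - a k z - (w - z) * b k) <= M k * (w - z) ^ 2) ->
  is_derive (fun w => Series (fun k => a k w)) z (Series b).
Proof.
  intros hc Ha Hb HM H.
  apply is_derive_quadratic_remainder with c (Series M); auto.
  intros w hw.
  assert (hz : ex_series (fun k => a k z)).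
  { apply Ha. rewrite Rminus_diag, Rabs_R0. exact hc. }
  specialize (Ha w hw).
  assert (Hle : forall k, 0 <= Rabs (a k w - a k z - (w - z) * b k) <= M k * (w - z) ^ 2).
  { intros k. split; [apply Rabs_pos|auto]. }
  assert (HM' : ex_series (fun k => M k * (w - z) ^ 2)).
  { now apply ex_series_scal_r. }
  rewrite <- Series_scal_l, <- !Series_minus, <- Series_scal_r; auto.
  - eapply Rle_trans; [apply Series_Rabs|now apply Series_le].
    now apply ex_series_nonneg_le with (1 := Hle).
  - now apply (ex_series_minus (V := R_NormedModule)).
  - now apply (ex_series_scal_l (V := R_NormedModule)).
Qed.

(** * The series for the logarithm of Gamma *)

Definition log_Gamma_term (k : nat) (z : R) : R :=
  z / INR (S k) - ln (1 + z / INR (S k)).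

Lemma ln_ge_1_sub_inv u : 0 < u -> 1 - / u <= ln u.
Proof.
  intros hu. pose proof (ln_le_sub1 (/ u) (Rinv_0_lt_compat _ hu)) as H.
  rewrite ln_Rinv in H; lra.
Qed.

Lemma log_Gamma_term_bounds k z : 0 <= z ->
  0 <= log_Gamma_term k z <= / INR (S k) ^ 2 * z ^ 2.
Proof.
  intros hz. unfold log_Gamma_term. pose proof (INR_S_ge_1 k). set (u := INR (S k)) in *.
  assert (h : 0 <= z / u).
  { apply Rmult_le_pos; auto. left. apply Rinv_0_lt_compat. lra. }
  replace (/ u ^ 2 * z ^ 2) with ((z / u) ^ 2) by (field; lra).
  set (r := z / u) in *.
  pose proof (ln_le_sub1 (1 + r) ltac:(lra)).
  pose proof (ln_ge_1_sub_inv (1 + r) ltac:(lra)).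
  split; [lra|].
  assert (r - r ^ 2 <= 1 - / (1 + r)); [|lra].
  replace (1 - / (1 + r)) with (r - r ^ 2 + r ^ 3 / (1 + r)) by (field; lra).
  assert (0 <= r ^ 3 / (1 + r)); [|lra].
  apply Rmult_le_pos; [now apply pow_le|]. left. apply Rinv_0_lt_compat. lra.
Qed.

Lemma ex_series_log_Gamma_term z : 0 <= z -> ex_series (fun k => log_Gamma_term k z).
Proof.
  intros hz. apply ex_series_nonneg_le with (fun k => / INR (S k) ^ 2 * z ^ 2).
  - intros k. now apply log_Gamma_term_bounds.
  - apply ex_series_scal_r, ex_series_inv_sqr.
Qed.

Lemma Gamma_2 : Gamma 2 = 1.
Proof.
  replace 2 with (1 + 1) by ring. rewrite Gamma_succ, Gamma_1 by lra. ring.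
Qed.

(** The lower ratio bound starting from [Gamma 2 = 1] gives
    [s * Gamma s = Gamma (s + 1) >= 1^(s-1)], a positive number. *)
Lemma Gamma_pos s : 1 <= s -> 0 < Gamma s.
Proof.
  intros hs. pose proof (Gamma_ratio_lower 1 (s - 1) ltac:(lra) ltac:(lra)) as H.
  replace (1 + 1) with 2 in H by ring. rewrite Gamma_2 in H.
  replace (2 + (s - 1)) with (s + 1) in H by ring.
  rewrite Gamma_succ in H by auto.
  assert (0 < Rpower 1 (s - 1)) by apply exp_pos. nra.
Qed.

Lemma ln_Gamma_succ s : 1 <= s -> ln (Gamma (s + 1)) = ln s + ln (Gamma s).
Proof.
  intros hs. rewrite Gamma_succ by auto. apply ln_mult; [lra|now apply Gamma_pos].
Qed.

Lemma ln_Gamma_ratio z n : 0 <= z ->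
  ln (Gamma (INR (S n) + 1 + z)) - ln (Gamma (INR (S n) + 1))
  = ln (Gamma (1 + z)) + sum_n (fun k => ln (1 + z / INR (S k))) n.
Proof.
  intros hz.
  assert (step : forall k, ln (INR (S k) + z) - ln (INR (S k)) = ln (1 + z / INR (S k))).
  { intros k. pose proof (INR_S_ge_1 k). rewrite <- ln_div by lra.
    f_equal. field. lra. }
  induction n as [|n IH].
  - rewrite sum_O, <- step. simpl INR.
    replace (1 + 1 + z) with (1 + z + 1) by ring.
    rewrite !ln_Gamma_succ, Gamma_1, ln_1 by lra.
    ring.
  - rewrite sum_n_S, <- step. pose proof (INR_S_ge_1 n). pose proof (INR_S_ge_1 (S n)).
    rewrite (ln_Gamma_succ (INR (S (S n)))) by auto.
    replace (INR (S (S n)) + 1 + z) with (INR (S (S n)) + z + 1) by ring.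
    rewrite ln_Gamma_succ by lra.
    replace (ln (Gamma (INR (S (S n)) + z))) with (ln (Gamma (INR (S n) + 1 + z)))
      by (rewrite (S_INR (S n)); reflexivity).
    replace (ln (Gamma (INR (S (S n))))) with (ln (Gamma (INR (S n) + 1)))
      by (rewrite (S_INR (S n)); reflexivity).
    lra.
Qed.

Lemma ln_Rpower u z : ln (Rpower u z) = z * ln u.
Proof. apply ln_exp. Qed.

(** With [N = n + 1], the upper ratio bound exceeds [z ln N] by
    [z ln (1 + (1 + z) / N)], which is at most [z (1 + z) / N]. *)
Lemma ln_Gamma_ratio_bounds z n : 0 <= z ->
  z * ln (INR (S n)) <=
    ln (Gamma (INR (S n) + 1 + z)) - ln (Gamma (INR (S n) + 1))
  <= z * ln (INR (S n)) + z * (1 + z) * / INR (S n).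
Proof.
  intros hz. pose proof (INR_S_ge_1 n). set (u := INR (S n)) in *.
  pose proof (Gamma_pos (u + 1) ltac:(lra)) as hG.
  pose proof (Gamma_pos (u + 1 + z) ltac:(lra)) as hG'.
  split.
  - pose proof (Gamma_ratio_lower u z ltac:(lra) hz) as H1.
    apply ln_le in H1; [|apply Rmult_lt_0_compat; auto; apply exp_pos].
    rewrite ln_mult, ln_Rpower in H1; auto; [lra|apply exp_pos].
  - pose proof (Gamma_ratio_upper (u + 1) z ltac:(lra) hz) as H1.
    apply ln_le in H1; auto.
    rewrite ln_mult, ln_Rpower in H1; auto; [|apply exp_pos].
    assert (h : 0 <= (1 + z) / u).
    { apply Rmult_le_pos; [lra|]. left. apply Rinv_0_lt_compat. lra. }
    pose proof (ln_le_sub1 (1 + (1 + z) / u) ltac:(lra)) as H2.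
    replace (u + 1 + z) with (u * (1 + (1 + z) / u)) in H1 at 2 by (field; lra).
    rewrite (ln_mult u) in H1 by lra.
    assert (z * ln (1 + (1 + z) / u) <= z * ((1 + z) / u))
      by (apply Rmult_le_compat_l; lra).
    unfold Rdiv in *. lra.
Qed.

Definition harmonic_minus_ln (n : nat) : R :=
  sum_n (fun k => / INR (S k)) n - ln (INR (S n)).

Lemma sum_n_log_Gamma_term z n :
  sum_n (fun k => log_Gamma_term k z) n
  = z * sum_n (fun k => / INR (S k)) n
    - sum_n (fun k => ln (1 + z / INR (S k))) n :> R.
Proof.
  unfold log_Gamma_term. induction n as [|n IH].
  - rewrite !sum_O. unfold Rdiv. ring.
  - rewrite !sum_n_S, IH. unfold Rdiv. ring.
Qed.

Lemma is_lim_seq_inv_INR_S : is_lim_seq (fun n => / INR (S n)) 0.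
Proof.
  apply (is_lim_seq_incr_1 (fun n => / INR n)).
  replace (Finite 0) with (Rbar_inv p_infty) by reflexivity.
  apply is_lim_seq_inv; [apply is_lim_seq_INR|discriminate].
Qed.

Lemma is_lim_seq_ln_Gamma z : 0 <= z ->
  is_lim_seq (fun n => sum_n (fun k => log_Gamma_term k z) n - z * harmonic_minus_ln n)
    (ln (Gamma (1 + z))).
Proof.
  intros hz. apply is_lim_seq_le_le with
    (fun n => ln (Gamma (1 + z)) - z * (1 + z) * / INR (S n)) (fun n => ln (Gamma (1 + z))).
  - intros n. pose proof (ln_Gamma_ratio_bounds z n hz) as H.
    rewrite ln_Gamma_ratio in H by auto.
    rewrite sum_n_log_Gamma_term. unfold harmonic_minus_ln. lra.
  - replace (Finite (ln (Gamma (1 + z))))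
      with (Finite (ln (Gamma (1 + z)) - z * (1 + z) * 0)) by (f_equal; ring).
    apply is_lim_seq_minus'; [apply is_lim_seq_const|].
    apply (is_lim_seq_scal_l _ (z * (1 + z)) 0), is_lim_seq_inv_INR_S.
  - apply is_lim_seq_const.
Qed.

(** At [z = 1] the limit [ln (Gamma 2)] vanishes, so the convergence of the series
    of log-Gamma terms forces that of the sequence defining Euler's constant. *)
Lemma is_lim_seq_Euler_gamma : is_lim_seq harmonic_minus_ln Euler_gamma.
Proof.
  assert (H : is_lim_seq harmonic_minus_ln (Series (fun k => log_Gamma_term k 1))).
  { replace (Series (fun k => log_Gamma_term k 1))
      with (Series (fun k => log_Gamma_term k 1) - ln (Gamma (1 + 1)))
      by (replace (1 + 1) with 2 by ring; rewrite Gamma_2, ln_1; ring).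
    eapply is_lim_seq_ext.
    2: apply is_lim_seq_minus';
      [exact (Series_correct _ (ex_series_log_Gamma_term 1 Rle_0_1))
      |exact (is_lim_seq_ln_Gamma 1 Rle_0_1)].
    assert (E : forall a h : R, a - (a - 1 * h) = h) by (intros; ring).
    intros n. exact (E _ _). }
  unfold Euler_gamma. change (is_lim_seq harmonic_minus_ln (real (Lim_seq harmonic_minus_ln))).
  now rewrite (is_lim_seq_unique _ _ H).
Qed.

Lemma ln_Gamma_series z : 0 <= z ->
  ln (Gamma (1 + z)) = Series (fun k => log_Gamma_term k z) - Euler_gamma * z.
Proof.
  intros hz. apply Rbar_finite_eq.
  rewrite <- (is_lim_seq_unique _ _ (is_lim_seq_ln_Gamma z hz)).
  apply is_lim_seq_unique, is_lim_seq_minus'.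
  - exact (Series_correct _ (ex_series_log_Gamma_term z hz)).
  - rewrite Rmult_comm. apply (is_lim_seq_scal_l _ z Euler_gamma), is_lim_seq_Euler_gamma.
Qed.

(** * The series for digamma and trigamma *)

Definition digamma_term (k : nat) (z : R) : R := / INR (S k) - / (INR (S k) + z).

Lemma digamma_term_bounds k z : 0 <= z ->
  0 <= digamma_term k z <= / INR (S k) ^ 2 * z.
Proof.
  intros hz. unfold digamma_term. pose proof (INR_S_ge_1 k). set (u := INR (S k)) in *.
  replace (/ u - / (u + z)) with (/ (u * (u + z)) * z) by (field; lra).
  split.
  - apply Rmult_le_pos; auto. left. apply Rinv_0_lt_compat. nra.
  - apply Rmult_le_compat_r; auto. apply Rinv_le_contravar; nra.
Qed.

Lemma ex_series_digamma_term z : 0 <= z -> ex_series (fun k => digamma_term k z).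
Proof.
  intros hz. apply ex_series_nonneg_le with (fun k => / INR (S k) ^ 2 * z).
  - intros k. now apply digamma_term_bounds.
  - apply ex_series_scal_r, ex_series_inv_sqr.
Qed.

Lemma trigamma_term_bounds k z : 0 <= z ->
  0 <= / (INR (S k) + z) ^ 2 <= / INR (S k) ^ 2.
Proof.
  intros hz. pose proof (INR_S_ge_1 k). split.
  - left. apply Rinv_0_lt_compat. nra.
  - apply Rinv_le_contravar; nra.
Qed.

Lemma ex_series_trigamma_term z : 0 <= z -> ex_series (fun k => / (INR (S k) + z) ^ 2).
Proof.
  intros hz. apply ex_series_nonneg_le with (2 := ex_series_inv_sqr).
  intros k. now apply trigamma_term_bounds.
Qed.

(** The neighbourhood of radius [z] around [z > 0] is where the series are
    differentiated. *)
Lemma ball_nonneg z w : Rabs (w - z) < z -> 0 <= w.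
Proof. intros h. apply Rabs_def2 in h. lra. Qed.

(** With [q = (u + w) / (u + z)] the Taylor remainder of the term is
    [q - 1 - ln q], which lies between [0] and [q - 1 - (1 - 1/q)], and the latter
    equals [(w - z)^2 / ((u + z) (u + w))]. *)
Lemma is_derive_log_Gamma_series z : 0 < z ->
  is_derive (fun w => Series (fun k => log_Gamma_term k w)) z
    (Series (fun k => digamma_term k z)).
Proof.
  intros hz. apply is_derive_Series with (fun k => / INR (S k) ^ 2) z; auto.
  - intros w hw. apply ex_series_log_Gamma_term. exact (ball_nonneg z w hw).
  - apply ex_series_digamma_term. lra.
  - apply ex_series_inv_sqr.
  - intros k w hw. apply ball_nonneg in hw.
    unfold log_Gamma_term, digamma_term.
    pose proof (INR_S_ge_1 k). set (u := INR (S k)) in *.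
    replace (1 + w / u) with ((u + w) / u) by (field; lra).
    replace (1 + z / u) with ((u + z) / u) by (field; lra).
    rewrite !(ln_div _ u) by lra.
    pose proof (ln_le_sub1 ((u + w) / (u + z)) ltac:(apply Rdiv_lt_0_compat; lra)) as H1.
    pose proof (ln_ge_1_sub_inv ((u + w) / (u + z))
      ltac:(apply Rdiv_lt_0_compat; lra)) as H2.
    rewrite ln_div in H1, H2 by lra.
    replace (w / u - (ln (u + w) - ln u) - (z / u - (ln (u + z) - ln u))
             - (w - z) * (/ u - / (u + z)))
      with ((u + w) / (u + z) - 1 - (ln (u + w) - ln (u + z))) by (field; lra).
    rewrite Rabs_pos_eq by lra.
    apply Rle_trans with (/ ((u + z) * (u + w)) * (w - z) ^ 2).
    + replace (/ ((u + z) * (u + w)) * (w - z) ^ 2)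
        with ((u + w) / (u + z) - 1 - (1 - / ((u + w) / (u + z)))) by (field; lra).
      lra.
    + apply Rmult_le_compat_r; [apply pow2_ge_0|]. apply Rinv_le_contravar; nra.
Qed.

Lemma is_derive_digamma_series z : 0 < z ->
  is_derive (fun w => Series (fun k => digamma_term k w)) z
    (Series (fun k => / (INR (S k) + z) ^ 2)).
Proof.
  intros hz. apply is_derive_Series with (fun k => / INR (S k) ^ 2) z; auto.
  - intros w hw. apply ex_series_digamma_term. exact (ball_nonneg z w hw).
  - apply ex_series_trigamma_term. lra.
  - apply ex_series_inv_sqr.
  - intros k w hw. apply ball_nonneg in hw. unfold digamma_term.
    pose proof (INR_S_ge_1 k). set (u := INR (S k)) in *.
    replace (/ u - / (u + w) - (/ u - / (u + z)) - (w - z) * / (u + z) ^ 2)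
      with (- (/ ((u + z) ^ 2 * (u + w)) * (w - z) ^ 2)) by (field; lra).
    assert (hq : 0 < (u + z) ^ 2 * (u + w)) by (apply Rmult_lt_0_compat; nra).
    rewrite Rabs_Ropp, Rabs_pos_eq.
    2: { apply Rmult_le_pos; [left; now apply Rinv_0_lt_compat|apply pow2_ge_0]. }
    apply Rmult_le_compat_r; [apply pow2_ge_0|].
    apply Rinv_le_contravar; [nra|].
    apply Rle_trans with ((u + z) ^ 2); nra.
Qed.

Lemma locally_gt_1 s : 1 < s -> locally s (fun w => 1 < w).
Proof.
  intros hs. assert (h : 0 < s - 1) by lra. exists (mkposreal _ h). intros w hw.
  apply Rabs_def2 in hw. unfold minus, plus, opp in hw. simpl in hw. lra.
Qed.

Lemma is_derive_sub_1 (f : R -> R) s l :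
  is_derive f (s - 1) l -> is_derive (fun w => f (w - 1)) s l.
Proof.
  intros Hf. rewrite <- (Rmult_1_l l).
  apply (is_derive_comp (V := R_NormedModule) f (fun w => w - 1)); auto.
  auto_derive; auto.
Qed.

(** On [(1, +oo)] Gamma is the exponential of a termwise differentiable series. *)
Lemma digamma_series s : 1 < s ->
  Euler_gamma + digamma s = Series (fun k => digamma_term k (s - 1)).
Proof.
  intros hs. unfold digamma.
  set (L := fun w => Series (fun k => log_Gamma_term k (w - 1)) - Euler_gamma * (w - 1)).
  assert (HL : forall w, 1 < w -> Gamma w = exp (L w)).
  { intros w hw. unfold L. rewrite <- ln_Gamma_series by lra.
    replace (1 + (w - 1)) with w by ring. rewrite exp_ln; auto. apply Gamma_pos. lra. }
  assert (HD : is_derive L s (Series (fun k => digamma_term k (s - 1)) - Euler_gamma)).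
  { apply (is_derive_minus (V := R_NormedModule)
      (fun w => Series (fun k => log_Gamma_term k (w - 1)))).
    - apply (is_derive_sub_1 (fun w => Series (fun k => log_Gamma_term k w))).
      apply is_derive_log_Gamma_series. lra.
    - assert (HE : is_derive (fun w : R => Euler_gamma * (w - 1)) s Euler_gamma)
        by (auto_derive; auto; ring).
      exact HE. }
  assert (HG : Derive Gamma s
     = Gamma s * (Series (fun k => digamma_term k (s - 1)) - Euler_gamma)).
  { rewrite (HL s hs). apply is_derive_unique.
    apply is_derive_ext_loc with (fun w => exp (L w)).
    - apply filter_imp with (2 := locally_gt_1 s hs). intros w hw. now rewrite HL.
    - rewrite Rmult_comm.
      apply (is_derive_comp (V := R_NormedModule) exp L s); auto.
      apply is_derive_exp. }
  rewrite HG. pose proof (Gamma_pos s ltac:(lra)). field. lra.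
Qed.

Lemma trigamma_series s : 1 < s ->
  trigamma s = Series (fun k => / (INR (S k) + (s - 1)) ^ 2).
Proof.
  intros hs. unfold trigamma. apply is_derive_unique.
  apply is_derive_ext_loc with
    (fun w => Series (fun k => digamma_term k (w - 1)) - Euler_gamma).
  - apply filter_imp with (2 := locally_gt_1 s hs). intros w hw.
    rewrite <- digamma_series by auto. apply Rplus_minus_l.
  - rewrite <- (Rminus_0_r (Series _)).
    apply (is_derive_minus (V := R_NormedModule)
      (fun w => Series (fun k => digamma_term k (w - 1)))).
    + apply (is_derive_sub_1 (fun w => Series (fun k => digamma_term k w))).
      apply is_derive_digamma_series. lra.
    + apply (is_derive_const (V := R_NormedModule)).
Qed.

(** * The double series *)

Definition trigamma_double_term (x : R) (m n : nat) : R :=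
  / (INR (S n) + INR (S m) * x) ^ 2 / INR (S m) ^ 2.

(** The factor [2 / x] is included so that the term equals
    [2 / (m^2 n (n + m x))]. *)
Definition digamma_double_term (x : R) (m n : nat) : R :=
  2 / x * (digamma_term n (INR (S m) * x) / INR (S m) ^ 3).

Lemma INR_S_mul_pos m x : 0 < x -> 0 < INR (S m) * x.
Proof. intros hx. pose proof (INR_S_ge_1 m). nra. Qed.

Lemma ex_series_trigamma_double_row x m : 0 < x -> ex_series (trigamma_double_term x m).
Proof.
  intros hx. apply ex_series_scal_r, ex_series_trigamma_term.
  left. now apply INR_S_mul_pos.
Qed.

Lemma trigamma_double_row x m : 0 < x ->
  Series (trigamma_double_term x m) = trigamma (INR (S m) * x + 1) / INR (S m) ^ 2.
Proof.
  intros hx. pose proof (INR_S_mul_pos m x hx). unfold trigamma_double_term, Rdiv.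
  rewrite Series_scal_r, trigamma_series by lra. f_equal.
  apply Series_ext. intros n. now replace (INR (S m) * x + 1 - 1) with (INR (S m) * x) by ring.
Qed.

Lemma ex_series_trigamma_double x : 0 < x ->
  ex_series (fun m => Series (trigamma_double_term x m)).
Proof.
  intros hx.
  apply ex_series_nonneg_le with
    (fun m => Series (fun n => / INR (S n) ^ 2) * / INR (S m) ^ 2).
  2: apply (ex_series_scal_l (V := R_NormedModule)), ex_series_inv_sqr.
  intros m. pose proof (INR_S_mul_pos m x hx). unfold trigamma_double_term, Rdiv.
  rewrite Series_scal_r.
  assert (0 <= / INR (S m) ^ 2).
  { left. apply Rinv_0_lt_compat, pow_lt. pose proof (INR_S_ge_1 m). lra. }
  split.
  - apply Rmult_le_pos; auto.
    apply Rle_trans with (sum_n (fun n => / (INR (S n) + INR (S m) * x) ^ 2) 0).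
    + rewrite sum_O. apply trigamma_term_bounds. lra.
    + apply sum_n_le_Series; [intros; apply trigamma_term_bounds; lra|].
      apply ex_series_trigamma_term. lra.
  - apply Rmult_le_compat_r; auto.
    apply Series_le; [intros; apply trigamma_term_bounds; lra|apply ex_series_inv_sqr].
Qed.

Lemma ex_series_digamma_double_row x m : 0 < x -> ex_series (digamma_double_term x m).
Proof.
  intros hx. apply (ex_series_scal_l (V := R_NormedModule) (2 / x)).
  apply ex_series_scal_r, ex_series_digamma_term.
  left. now apply INR_S_mul_pos.
Qed.

Lemma digamma_double_row x m : 0 < x ->
  Series (digamma_double_term x m)
  = 2 / x * ((Euler_gamma + digamma (INR (S m) * x + 1)) / INR (S m) ^ 3).
Proof.
  intros hx. pose proof (INR_S_mul_pos m x hx). unfold digamma_double_term.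
  rewrite Series_scal_l, digamma_series by lra. unfold Rdiv. rewrite Series_scal_r.
  do 2 f_equal. apply Series_ext. intros n. f_equal. ring.
Qed.

Lemma ex_series_digamma_over_cube x : 0 < x ->
  ex_series (fun k => (Euler_gamma + digamma (INR (S k) * x + 1)) / INR (S k) ^ 3).
Proof.
  intros hx.
  apply ex_series_nonneg_le with
    (fun m => Series (fun n => / INR (S n) ^ 2) * x * / INR (S m) ^ 2).
  2: apply (ex_series_scal_l (V := R_NormedModule)), ex_series_inv_sqr.
  intros m. pose proof (INR_S_mul_pos m x hx). pose proof (INR_S_ge_1 m).
  rewrite digamma_series by lra.
  replace (INR (S m) * x + 1 - 1) with (INR (S m) * x) by ring.
  assert (0 <= / INR (S m) ^ 3).
  { left. apply Rinv_0_lt_compat, pow_lt. lra. }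
  split.
  - apply Rmult_le_pos; auto.
    apply Rle_trans with (sum_n (fun n => digamma_term n (INR (S m) * x)) 0).
    + rewrite sum_O. apply digamma_term_bounds. lra.
    + apply sum_n_le_Series; [intros; apply digamma_term_bounds; lra|].
      apply ex_series_digamma_term. lra.
  - replace (Series (fun n => / INR (S n) ^ 2) * x * / INR (S m) ^ 2)
      with (Series (fun n => / INR (S n) ^ 2) * (INR (S m) * x) * / INR (S m) ^ 3)
      by (field; lra).
    apply Rmult_le_compat_r; auto. rewrite <- Series_scal_r.
    apply Series_le; [intros; apply digamma_term_bounds; lra|].
    apply ex_series_scal_r, ex_series_inv_sqr.
Qed.

(** The roles of the indices are exchanged in the second term, so that after
    clearing [x] its denominator [(m + n / x)^2] matches [(n + m x)^2]. *)
Lemma double_term_identity x m n : 0 < x ->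
  - trigamma_double_term x m n + trigamma_double_term (/ x) n m
  + digamma_double_term x m n = / INR (S m) ^ 2 * / INR (S n) ^ 2.
Proof.
  intros hx. unfold trigamma_double_term, digamma_double_term, digamma_term.
  pose proof (INR_S_ge_1 m). pose proof (INR_S_ge_1 n). field.
  repeat split; nra.
Qed.

Lemma zeta_2 : zeta 2 = Series (fun n => / INR (S n) ^ 2).
Proof.
  apply Series_ext. intros n. pose proof (INR_S_ge_1 n).
  replace 2 with (INR 2) by (simpl; ring). rewrite Rpower_pow by lra. reflexivity.
Qed.

Theorem mainTheorem6 (x : R) (hx : 0 < x) :
  ex_series (fun k => trigamma (INR (S k) * x + 1) / INR (S k) ^ 2) /\
  ex_series (fun k => trigamma (INR (S k) / x + 1) / INR (S k) ^ 2) /\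
  ex_series (fun k => (Euler_gamma + digamma (INR (S k) * x + 1)) / INR (S k) ^ 3) /\
  - Series (fun k => trigamma (INR (S k) * x + 1) / INR (S k) ^ 2)
  + Series (fun k => trigamma (INR (S k) / x + 1) / INR (S k) ^ 2)
  + 2 / x * Series (fun k =>
      (Euler_gamma + digamma (INR (S k) * x + 1)) / INR (S k) ^ 3)
  = zeta 2 ^ 2.
Proof.
  assert (hx' : 0 < / x) by now apply Rinv_0_lt_compat.
  assert (row : forall k, Series (trigamma_double_term x k)
                = trigamma (INR (S k) * x + 1) / INR (S k) ^ 2)
    by (intros k; now apply trigamma_double_row).
  assert (row' : forall k, Series (trigamma_double_term (/ x) k)
                = trigamma (INR (S k) / x + 1) / INR (S k) ^ 2)
    by (intros k; now apply trigamma_double_row).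
  destruct (Series_swap (trigamma_double_term (/ x))) as (Hcol & HexC & HC).
  { intros m n. unfold trigamma_double_term.
    pose proof (INR_S_mul_pos m _ hx'). pose proof (INR_S_ge_1 m). pose proof (INR_S_ge_1 n).
    left. apply Rdiv_lt_0_compat; [apply Rinv_0_lt_compat|]; apply pow_lt; lra. }
  { intros m. now apply ex_series_trigamma_double_row. }
  { now apply ex_series_trigamma_double. }
  split; [|split; [|split]].
  - apply ex_series_ext with (1 := row). now apply ex_series_trigamma_double.
  - apply ex_series_ext with (1 := row'). now apply ex_series_trigamma_double.
  - now apply ex_series_digamma_over_cube.
  - rewrite <- (Series_ext _ _ row), <- (Series_ext _ _ row'), <- HC, <- Series_scal_l.
    rewrite <- (Series_ext _ _ (fun m => digamma_double_row x m hx)).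
    rewrite <- Series_opp.
    assert (HP : ex_series (fun m => - Series (trigamma_double_term x m))).
    { apply (ex_series_opp (V := R_NormedModule)). now apply ex_series_trigamma_double. }
    assert (HR : ex_series (fun m => Series (digamma_double_term x m))).
    { eapply ex_series_ext.
      { intros m. symmetry. now apply digamma_double_row. }
      apply (ex_series_scal_l (V := R_NormedModule) (2 / x)). now apply ex_series_digamma_over_cube. }
    rewrite <- Series_plus by auto.
    rewrite <- Series_plus; auto.
    2: { now apply (ex_series_plus (V := R_NormedModule)). }
    rewrite zeta_2. set (Z := Series (fun n => / INR (S n) ^ 2)).
    replace (Z ^ 2) with (Z * Z) by ring. unfold Z at 1. rewrite <- Series_scal_r.
    apply Series_ext. intros m. unfold Z. rewrite <- Series_scal_l.
    assert (hP : ex_series (fun n => - trigamma_double_term x m n)).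
    { apply (ex_series_opp (V := R_NormedModule) (trigamma_double_term x m)).
      now apply ex_series_trigamma_double_row. }
    assert (hR := ex_series_digamma_double_row x m hx).
    specialize (Hcol m).
    rewrite <- Series_opp, <- !Series_plus; auto.
    + apply Series_ext. intros n. now apply double_term_identity.
    + now apply (ex_series_plus (V := R_NormedModule)).
Qed.
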